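(* For every $k,m,n\in\mathbb{N}$ such that $k\mid mn$, the number $s_k(m,n)$ of subgroups of order $k$ of the group $\mathbb{Z}_m\times\mathbb{Z}_n$ is given by $$s_k(m,n)=\sum_{\substack{a\mid m,\ b\mid n\\ mb/a=k}}\gcd(a,b)=\sum_{\substack{d\mid\gcd(k,m)\\ e\mid\gcd(k,n)\\ k\mid de}}\phi(de/k)=\sum_{d\mid\gcd(m,n,k)}\phi(d)\,N(m/d,n/d,k/d).$$
   Context: $\mathbb{N}=\{1,2,\ldots\}$. $\mathbb{Z}_m$ denotes the additive group of residue classes modulo $m$. $\phi$ is Euler's totient function. For $a,b,c\in\mathbb{N}$, $N(a,b,c)$ denotes the number of solutions $(x,y,z,t)\in\mathbb{N}^4$ of the system of equations $xy=a$, $zt=b$, $xz=c$. All divisors in the sums are positive. *)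

(* Defs.v *)
From mathcomp Require Import all_boot all_order all_fingroup all_algebra.

Set Implicit Arguments.
Unset Strict Implicit.
Unset Printing Implicit Defensive.

Local Open Scope nat_scope.

(* [Zp m] is all of ['Z_m] when [1 < m] and the trivial subgroup of ['Z_1]
   (whose carrier has two elements) when [m = 1], so this is the group
   Z_m x Z_n for all positive m and n. *)
Definition ZxZ (m n : nat) : {group ('Z_m * 'Z_n)%type} :=
  setX_group (Zp_group m) (Zp_group n).

Definition num_subgroups (gT : finGroupType) (G : {group gT}) (k : nat) : nat :=
  #|[set H in subgroups G | #|H| == k]|.

Definition is_solution (a b c x y z t : nat) : bool :=
  [&& 0 < x, 0 < y, 0 < z, 0 < t, x * y == a, z * t == b & x * z == c].

(* The ranges x, y <= a and z, t <= b only serve to make the count finite: by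
   [num_solutionsE] they exclude no solution in positive integers. *)
Definition num_solutions (a b c : nat) : nat :=
  #|[set q : 'I_a.+1 * 'I_a.+1 * 'I_b.+1 * 'I_b.+1 |
      let: (x, y, z, t) := q in is_solution a b c x y z t]|.

Lemma num_solutionsE (a b c : nat) (s : seq (nat * nat * nat * nat)) :
  uniq s ->
  (forall x y z t, ((x, y, z, t) \in s) = is_solution a b c x y z t) ->
  num_solutions a b c = size s.
Proof.
move=> s_uniq sP; rewrite /num_solutions cardE.
pose f (q : 'I_a.+1 * 'I_a.+1 * 'I_b.+1 * 'I_b.+1) : nat * nat * nat * nat :=
  let: (x, y, z, t) := q in (nat_of_ord x, nat_of_ord y, nat_of_ord z, nat_of_ord t).
have f_inj : injective f.
  by move=> [[[x y] z] t] [[[x' y'] z'] t'] /= [] /val_inj-> /val_inj-> /val_inj-> /val_inj->.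
rewrite -(size_map f); apply/perm_size/uniq_perm => //.
  by rewrite (map_inj_uniq f_inj) enum_uniq.
move=> [[[x y] z] t]; rewrite sP; apply/mapP/idP => [[[[[x' y'] z'] t']]|sol].
  by rewrite mem_enum inE => sol [-> -> -> ->].
have [xa ya zb tb] : [/\ x < a.+1, y < a.+1, z < b.+1 & t < b.+1].
  case/and5P: sol => x0 y0 z0 t0 /and3P[/eqP<- /eqP<- _].
  by rewrite !ltnS leq_pmulr // leq_pmull // leq_pmulr // leq_pmull.
by exists (Ordinal xa, Ordinal ya, Ordinal zb, Ordinal tb); rewrite ?mem_enum ?inE.
Qed.

(* Main.v *)
Require Import Defs.
From mathcomp Require Import all_boot all_order all_fingroup all_algebra.
From mathcomp Require Import cyclic zify.

Local Open Scope nat_scope.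

(** Write m and n for the orders of the two cyclic factors, generated by g and
    h.  A subgroup H of <[g]> x <[h]> is recorded by its lattice of exponents,
    the pairs (u, v) with (g ^+ u, h ^+ v) in H.  Such a lattice has a Hermite
    normal form (a, c, s): a generates its intersection with the first axis, c
    generates its projection to the second axis, s < a, and (u, v) belongs to
    it exactly when c divides v and a divides u + s * (v %/ c)
    ([subgroup_of_setX_cycle]).  It contains m Z x n Z exactly when a %| m,
    c %| n and a %| s * (n %/ c), and the subgroup then has order
    (m %/ a) * (n %/ c) ([card_sublattice_group]).

    With b = n %/ c, the subgroups of order k thus correspond to the triples
    (a, b, s) where a %| m, b %| n, m * b %/ a = k, s < a and a %| s * b.  For
    given a and b there are gcdn a b such s ([size_annihilators]), which is the
    first formula ([num_subgroups_setX_cycle]).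

    The other two formulas follow on expanding gcdn a b as the sum of totient c
    over the common divisors c of a and b.  Put x = m %/ a, so that k = x * b.
    For the second, (a, b, c) |-> (c * x, b) is a bijection onto the pairs
    (d, e) of that formula, with d * e %/ k = c ([sum_gcdn_totient_mul]).  For
    the third, exchange the two summations: for each c, the pairs (a, b) that c
    divides correspond to the solutions (x, a %/ c, b %/ c, n %/ b) of the
    system for (m %/ c, n %/ c, k %/ c) ([sum_gcdn_num_solutions]). *)

(** * Sums over pairs of divisors *)

Lemma sum_totient_divisors n :
  0 < n -> \sum_(d <- divisors n) totient d = n.
Proof.
move=> n_gt0; rewrite -[RHS]sum_totient_dvd.
rewrite -(big_mkord (fun d => d %| n) totient) -[in RHS]big_filter.
apply: perm_big; apply: uniq_perm; rewrite ?divisors_uniq ?filter_uniq ?iota_uniq//.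
move=> d; rewrite mem_filter mem_index_iota -dvdn_divisors //= ltnS.
by apply/idP/andP=> [dn|[]//]; rewrite dn dvdn_leq.
Qed.

(** The index set of the first formula as a duplicate-free list: the pairs
    (a, b) with a %| m, b %| n and m * b %/ a = k.  It is the common form to
    which all the sums are reduced. *)
Definition divisor_pairs (k m n : nat) : seq (nat * nat) :=
  [seq p <- [seq (a, b) | a <- divisors m, b <- divisors n] | m * p.2 %/ p.1 == k].

Lemma mem_pairs (s t : seq nat) a b :
  ((a, b) \in [seq (x, y) | x <- s, y <- t]) = (a \in s) && (b \in t).
Proof.
apply/allpairsP/andP => [[[x y] /= [? ? [-> ->]]] //|[? ?]].
by exists (a, b).
Qed.

Lemma uniq_pairs (s t : seq nat) :
  uniq s -> uniq t -> uniq [seq (x, y) | x <- s, y <- t].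
Proof. by move=> us ut; apply: allpairs_uniq => // -[? ?] [? ?] _ _ [-> ->]. Qed.

Lemma mem_divisor_pairs k m n a b : 0 < m -> 0 < n ->
  ((a, b) \in divisor_pairs k m n) = [&& a %| m, b %| n & m * b == k * a].
Proof.
move=> m0 n0; rewrite mem_filter mem_pairs -!dvdn_divisors //= andbC -andbA.
case: (boolP (a %| m)) => //= am; case: (b %| n) => //=.
by rewrite eq_sym eqn_div ?(dvdn_gt0 _ am) ?dvdn_mulr // eq_sym.
Qed.

Lemma divisor_pairs_uniq k m n : uniq (divisor_pairs k m n).
Proof. by rewrite filter_uniq // uniq_pairs ?divisors_uniq. Qed.

Lemma big_divisor_pairs k m n (F : nat -> nat -> nat) :
  \sum_(a <- divisors m) \sum_(b <- divisors n | m * b %/ a == k) F a b =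
  \sum_(p <- divisor_pairs k m n) F p.1 p.2.
Proof.
rewrite big_filter [RHS]big_mkcond big_allpairs.
by apply: eq_bigr => a _; rewrite [LHS]big_mkcond.
Qed.

Lemma sum_gcdn_totient_mul k m n : 0 < k -> 0 < m -> 0 < n ->
  \sum_(p <- divisor_pairs k m n) gcdn p.1 p.2 =
  \sum_(d <- divisors (gcdn k m))
    \sum_(e <- divisors (gcdn k n) | k %| d * e) totient (d * e %/ k).
Proof.
move=> k0 m0 n0.
(* T indexes the sum after the expansion of the gcd, and f is the bijection
   from T to the index set of the right-hand side. *)
pose T := [seq (p, c) | p <- divisor_pairs k m n, c <- divisors (gcdn p.1 p.2)].
pose f t : nat * nat := (t.2 * (m %/ t.1.1), t.1.2).
(* The witnesses are x = m %/ a and y = n %/ b. *)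
have TP a b c : reflect (exists x y, [/\ m = x * a, k = x * b, n = y * b,
    c %| a & c %| b]) ((a, b, c) \in T).
  apply: (iffP allpairsPdep) => [[[a' b'] [c' []]]|[x [y [Dm Dk Dn ca cb]]]].
    rewrite mem_divisor_pairs // => /and3P[/dvdnP[x Dm] /dvdnP[y Dn] /eqP Dk].
    rewrite -dvdn_divisors /=; last by rewrite gcdn_gt0; nia.
    rewrite dvdn_gcd => /andP[ca cb] [-> -> ->]; exists x, y; split=> //; nia.
  exists (a, b), c; rewrite mem_divisor_pairs // -dvdn_divisors /=; last first.
    by rewrite gcdn_gt0; nia.
  rewrite dvdn_gcd ca cb; split=> //; rewrite {1}Dm Dn !dvdn_mull //=.
  by apply/eqP; nia.
rewrite (eq_big_seq (fun p => \sum_(c <- divisors (gcdn p.1 p.2)) totient c)).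
  rewrite -(big_allpairs_dep (h := pair) (F := fun t => totient t.2)) /=.
  rewrite -/T.
  rewrite [RHS](_ : _ = \sum_(q <- map f T) totient (q.1 * q.2 %/ k)).
    rewrite big_map; apply: eq_big_seq => -[[a b] c] /TP[x [y [Dm Dk Dn ca cb]]].
    rewrite /= {1}Dm mulnK; last by nia.
    by rewrite -mulnA -Dk mulnK.
  rewrite [RHS](_ : _ = \sum_(q <- [seq q <- [seq (d, e) | d <- divisors (gcdn k m),
    e <- divisors (gcdn k n)] | k %| q.1 * q.2]) totient (q.1 * q.2 %/ k)).
    rewrite big_filter [RHS]big_mkcond big_allpairs.
    by apply: eq_bigr => d _; rewrite [LHS]big_mkcond.
  apply: perm_big; apply: uniq_perm.
  - rewrite map_inj_in_uniq.
      apply: allpairs_uniq_dep => [|p _|]; rewrite ?divisors_uniq ?divisor_pairs_uniq //.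
      by move=> [? ?] [? ?] _ _ /= [-> ->].
    move=> [[a b] c] [[a' b'] c'] /TP[x [y [Dm Dk _ _ _]]].
    move=> /TP[x' [y' [Dm' Dk' _ _ _]]] [/=].
    rewrite {1}Dm {1}Dm' !mulnK; try nia.
    move=> Dcx Db; subst b'.
    have Dx : x = x' by nia.
    subst x'; have -> : a = a' by nia.
    by have -> : c = c' by nia.
  - by rewrite filter_uniq // uniq_pairs ?divisors_uniq.
  move=> [d e]; rewrite mem_filter mem_pairs -!dvdn_divisors ?gcdn_gt0 ?k0 //.
  rewrite !dvdn_gcd /=; apply/mapP/idP => [[[[a b] c]]|].
    move=> /TP[x [y [Dm Dk Dn ca cb]]] [-> ->] /=.
    have -> : m %/ a = x by rewrite Dm mulnK //; nia.
    have cxk : c * x %| k by rewrite Dk mulnC dvdn_mul.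
    have cxm : c * x %| m by rewrite Dm mulnC dvdn_mul.
    have bk : b %| k by rewrite Dk dvdn_mull.
    by rewrite cxk cxm bk -mulnA -Dk Dn !dvdn_mull.
  case/and3P=> kde /andP[dk dm] /andP[/dvdnP[x Dk] en].
  have e0 : 0 < e by nia.
  have /dvdnP[c Dd] : x %| d by rewrite -(dvdn_pmul2r e0) -Dk.
  have /dvdnP[a Dm] : x %| m by rewrite (dvdn_trans _ dm) // Dd dvdn_mull.
  have x0 : 0 < x by nia.
  case/dvdnP: en => y Dn.
  exists (a, e, c); last by rewrite /f /= {1}Dm mulKn ?Dd //; nia.
  apply/TP; exists x, y; split; rewrite // 1?(mulnC x) //.
    by rewrite -(dvdn_pmul2r x0) -Dd -Dm.
  by rewrite -(dvdn_pmul2r x0) -Dd (mulnC e) -Dk.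
move=> [a b]; rewrite mem_divisor_pairs // => /and3P[am bn _].
by rewrite sum_totient_divisors // gcdn_gt0 (dvdn_gt0 m0 am).
Qed.

Lemma sum_gcdn_num_solutions k m n : 0 < k -> 0 < m -> 0 < n ->
  \sum_(p <- divisor_pairs k m n) gcdn p.1 p.2 =
  \sum_(d <- divisors (gcdn (gcdn m n) k))
    totient d * num_solutions (m %/ d) (n %/ d) (k %/ d).
Proof.
move=> k0 m0 n0.
pose D := divisors (gcdn (gcdn m n) k).
have DP d : (d \in D) = [&& d %| m, d %| n & d %| k].
  by rewrite -dvdn_divisors ?gcdn_gt0 ?m0 // !dvdn_gcd andbA.
transitivity (\sum_(p <- divisor_pairs k m n)
    \sum_(d <- D | d %| gcdn p.1 p.2) totient d).
  apply: eq_big_seq => -[a b]; rewrite mem_divisor_pairs // => /and3P[am bn /eqP Dk].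
  have a0 := dvdn_gt0 m0 am.
  rewrite -big_filter -[LHS]sum_totient_divisors ?gcdn_gt0 ?a0 //.
  apply/perm_big/uniq_perm; rewrite ?filter_uniq ?divisors_uniq //.
  move=> d; rewrite mem_filter DP -dvdn_divisors ?gcdn_gt0 ?a0 //.
  apply/idP/andP => [dab|[]//]; split=> //; move: dab.
  rewrite dvdn_gcd /= => /andP[da db].
  rewrite (dvdn_trans da am) (dvdn_trans db bn) /=.
  apply: dvdn_trans db _; case/dvdnP: am => x Dm.
  have -> : k = x * b by nia.
  exact: dvdn_mull.
rewrite (exchange_big_dep predT) //=; apply: eq_big_seq => d.
rewrite DP => /and3P[/dvdnP[m' Dm] /dvdnP[n' Dn] /dvdnP[k' Dk]].
have d0 : 0 < d by nia.
rewrite -big_filter big_const_seq count_predT iter_addn_0; congr (_ * _).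
set s := filter _ _.
(* The witnesses (x, y, z, t) form the solution attached to (a, b). *)
have sP a b : (a, b) \in s <-> exists x y z t,
    [/\ a = y * d, b = z * d, m' = x * y, n' = z * t & k' = x * z].
  rewrite mem_filter mem_divisor_pairs //= dvdn_gcd; split.
    case/andP=> /andP[/dvdnP[y ->] /dvdnP[z ->]].
    case/and3P=> /dvdnP[x Dx] /dvdnP[t Dt] /eqP E.
    have {Dx} Dm' : m' = x * y.
      by apply/eqP; rewrite -(eqn_pmul2r d0) -Dm Dx mulnA.
    exists x, y, z, t; split=> //; apply/eqP; rewrite -(eqn_pmul2r d0).
      by rewrite -Dn Dt mulnA (mulnC z).
    have y0 : 0 < y by nia.
    by rewrite -(eqn_pmul2r y0) -(eqn_pmul2r d0) -Dk -mulnA -E Dm Dm'; lia.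
  case=> x [y [z [t [-> -> Dm' Dn' Dk']]]]; rewrite !dvdn_mull //=.
  have -> : y * d %| m by rewrite Dm Dm' -mulnA dvdn_mull.
  have -> : z * d %| n by rewrite Dn Dn' -mulnA mulnCA dvdn_mull.
  by apply/eqP; rewrite Dm Dm' Dk Dk'; lia.
(* f maps the list s bijectively onto the set of solutions. *)
pose f p := (m %/ p.1, p.1 %/ d, p.2 %/ d, n %/ p.2).
rewrite -(size_map f); apply/esym/num_solutionsE.
  rewrite map_inj_in_uniq; first exact/filter_uniq/divisor_pairs_uniq.
  move=> [a b] [a' b'] /sP[? [y [z [_ [-> -> _ _ _]]]]].
  by move=> /sP[? [y' [z' [_ [-> -> _ _ _]]]]] [_]; rewrite !mulnK // => -> ->.
have fE x y z t : m' = x * y -> n' = z * t -> 0 < y -> 0 < z ->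
    f (y * d, z * d) = (x, y, z, t).
  move=> Dm' Dn' y0 z0; rewrite /f /= !mulnK // Dm Dm' -mulnA mulnK ?muln_gt0 ?y0 //.
  by rewrite Dn Dn' (mulnC z) -mulnA mulnK ?muln_gt0 ?z0.
move=> x y z t; rewrite /is_solution Dm Dn Dk !mulnK //; apply/mapP/and5P.
  case=> -[a b] /sP[x' [y' [z' [t' [-> -> Dm' Dn' Dk']]]]].
  rewrite (fE x' y' z' t') //; try nia.
  by case=> -> -> -> ->; split; try nia; rewrite Dm' Dn' Dk' !eqxx; nia.
case=> x0 y0 z0 t0 /and3P[/eqP Dm' /eqP Dn' /eqP Dk'].
by exists (y * d, z * d); [apply/sP; exists x, y, z, t | rewrite (fE x y z t)].
Qed.

(** * Sublattices of pairs of exponents *)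

(** The solutions of s * b = 0 modulo a are the multiples of a %/ gcdn a b. *)
Lemma size_annihilators a b : 0 < a ->
  size [seq s <- iota 0 a | a %| s * b] = gcdn a b.
Proof.
move=> a0; set d := gcdn a b; have d0 : 0 < d by rewrite gcdn_gt0 a0.
have /dvdnP[a' Da] : d %| a by exact: dvdn_gcdl.
have /dvdnP[b' Db] : d %| b by exact: dvdn_gcdr.
have a'0 : 0 < a' by nia.
have cop : coprime a' b'.
  rewrite /coprime -(eqn_pmul2r d0) muln_gcdl mul1n -Da -Db; exact/eqP.
have annE s : (a %| s * b) = (a' %| s).
  by rewrite {1}Da {1}Db mulnA dvdn_pmul2r // Gauss_dvdl.
rewrite -(size_iota 0 d) -[RHS](size_map (muln a')); apply/perm_size/uniq_perm.
- by rewrite filter_uniq ?iota_uniq.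
- by rewrite map_inj_uniq ?iota_uniq // => i j /eqP; rewrite eqn_pmul2l // => /eqP.
move=> s; rewrite mem_filter annE mem_iota; apply/andP/mapP => [[]|[i]].
  case/dvdnP=> i ->; rewrite add0n Da mulnC /= ltn_pmul2l // => id.
  by exists i; rewrite ?mem_iota.
by rewrite mem_iota !add0n /= => id ->; rewrite dvdn_mulr // Da ltn_pmul2l.
Qed.

(** Membership of (u, v) in the lattice spanned by (a, 0) and (- s, c).  The
    sign of s avoids subtraction in nat.  Only pairs of natural numbers are
    tested, which loses nothing for a lattice of exponents of a finite group. *)
Definition sublattice (a c s u v : nat) : bool :=
  (c %| v) && (a %| u + s * (v %/ c)).

Lemma sublattice_row a c s u : sublattice a c s u 0 = (a %| u).
Proof. by rewrite /sublattice dvdn0 div0n muln0 addn0. Qed.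

Lemma sublatticeD a c s u v u' v' : sublattice a c s u v ->
  sublattice a c s (u + u') (v + v') = sublattice a c s u' v'.
Proof.
case/andP=> cv auv; rewrite /sublattice dvdn_addr //.
by rewrite divnDl // mulnDr addnACA dvdn_addr.
Qed.

(** The three hypotheses say that the lattice contains (m, 0) and (0, n). *)
Lemma sublattice_mod a c s m n u v : a %| m -> c %| n -> a %| s * (n %/ c) ->
  sublattice a c s (u %% m) (v %% n) = sublattice a c s u v.
Proof.
move=> am cn asb; rewrite [in RHS](divn_eq u m) [in RHS](divn_eq v n).
rewrite -(sublatticeD _ _ _ (u %/ m * m) (v %/ n * n)) //.
rewrite /sublattice dvdn_mull //= dvdn_add //; first exact: dvdn_mull.
by rewrite -muln_divA // mulnCA dvdn_mull.
Qed.

(** The parameters of a lattice in Hermite normal form are unique. *)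
Lemma sublattice_inj a c s a' c' s' : 0 < a -> 0 < a' -> 0 < c -> 0 < c' ->
    s < a -> s' < a' ->
    (forall u v, sublattice a c s u v = sublattice a' c' s' u v) ->
  [/\ a = a', c = c' & s = s'].
Proof.
move=> a0 a'0 c0 c'0 sa sa' E.
have Da : a = a'.
  apply/eqP; rewrite eqn_dvd -(sublattice_row a c s) E sublattice_row dvdnn.
  by rewrite -(sublattice_row a' c' s') -E sublattice_row dvdnn.
(* (a - r, d) represents the generator (- r, d) modulo (a, 0). *)
subst a'; have lastcol r d : 0 < d -> r < a -> sublattice a d r (a - r) d.
  by move=> d0 ra; rewrite /sublattice dvdnn divnn d0 muln1 subnK ?dvdnn // ltnW.
have Dc : c = c'.
  apply/eqP; rewrite eqn_dvd.
  have := lastcol s c c0 sa; rewrite E => /andP[-> _].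
  by have := lastcol s' c' c'0 sa'; rewrite -E => /andP[-> _].
subst c'; split=> //.
have := lastcol s c c0 sa; rewrite E => /andP[_].
rewrite divnn c0 muln1 => /dvdnP[[|[|q]]]; rewrite ?mulSn; lia.
Qed.

(** * Subgroups of a product of two cyclic groups *)

Lemma expg_pair {gT1 gT2 : finGroupType} (x : gT1) (y : gT2) i :
  ((x, y) ^+ i = (x ^+ i, y ^+ i))%g.
Proof. by elim: i => // i IHi; rewrite !expgS IHi. Qed.

Lemma mulg_pair {gT1 gT2 : finGroupType} (x x' : gT1) (y y' : gT2) :
  ((x, y) * (x', y') = (x * x', y * y'))%g.
Proof. by []. Qed.

Lemma setX_cycleP {gT1 gT2 : finGroupType} (g : gT1) (h : gT2) p :
  reflect (exists u v, p = (g ^+ u, h ^+ v)%g) (p \in setX <[g]>%g <[h]>%g).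
Proof.
case: p => x y; rewrite in_setX; apply: (iffP andP) => [[]|[u [v [-> ->]]]].
  by move=> /cycleP[u ->] /cycleP[v ->]; exists u, v.
by rewrite !mem_cycle.
Qed.

(** The subgroup of <[g]> x <[h]> whose exponents form the lattice
    [sublattice a c s].  Taking the generated subgroup makes this a group for
    all a, c and s; when the lattice contains (#[g], 0) and (0, #[h]), the
    generating set is already a group, see [mem_sublattice_group]. *)
Definition sublattice_group {gT1 gT2 : finGroupType} (g : gT1) (h : gT2)
    (a c s : nat) : {group (gT1 * gT2)%type} :=
  <<[set (g ^+ val uv.1, h ^+ val uv.2)%g |
      uv : 'I_#[g]%g * 'I_#[h]%g & sublattice a c s uv.1 uv.2]>>%G.

Lemma mem_sublattice_group {gT1 gT2 : finGroupType} (g : gT1) (h : gT2) a c s u v :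
    a %| #[g]%g -> c %| #[h]%g -> a %| s * (#[h]%g %/ c) ->
  ((g ^+ u, h ^+ v)%g \in sublattice_group g h a c s) = sublattice a c s u v.
Proof.
move=> am cn asb.
set S := [set (g ^+ val uv.1, h ^+ val uv.2)%g |
  uv : 'I_#[g]%g * 'I_#[h]%g & sublattice a c s uv.1 uv.2].
have memS i j : ((g ^+ i, h ^+ j)%g \in S) = sublattice a c s i j.
  apply/imsetP/idP => [[[i' j'] /=]|sij].
    rewrite inE /= => si'j' [/eqP Di /eqP Dj].
    rewrite !eq_expg_mod_order in Di Dj.
    rewrite -(sublattice_mod _ _ _ _ _ i j am cn asb) (eqP Di) (eqP Dj).
    by rewrite sublattice_mod.
  exists (Ordinal (ltn_pmod i (order_gt0 g)), Ordinal (ltn_pmod j (order_gt0 h))).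
    by rewrite inE /= sublattice_mod.
  by rewrite /= !expg_mod_order.
have SX p : p \in S -> exists i j, p = (g ^+ i, h ^+ j)%g.
  by case/imsetP=> -[i j] _ ->; exists i, j.
have gS : group_set S.
  apply/group_setP; split.
    by rewrite (_ : 1%g = (g ^+ 0, h ^+ 0)%g) // memS sublattice_row.
  move=> p q pS qS; have [[i [j Dp]] [i' [j' Dq]]] := (SX p pS, SX q qS).
  move: pS qS; rewrite {}Dp {}Dq mulg_pair -!expgD !memS => sij.
  by rewrite sublatticeD.
by rewrite /sublattice_group /= gen_set_id // memS.
Qed.

Lemma sublattice_group_subX {gT1 gT2 : finGroupType} (g : gT1) (h : gT2) a c s :
  sublattice_group g h a c s \subset setX <[g]>%g <[h]>%g.
Proof.
rewrite gen_subG; apply/subsetP=> _ /imsetP[[u v] _ ->].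
by rewrite in_setX !mem_cycle.
Qed.

Lemma card_sublattice_group {gT1 gT2 : finGroupType} (g : gT1) (h : gT2) a c s :
    a %| #[g]%g -> c %| #[h]%g -> a %| s * (#[h]%g %/ c) ->
  #|sublattice_group g h a c s| = (#[g]%g %/ a) * (#[h]%g %/ c).
Proof.
set m := #[g]%g; set n := #[h]%g => am cn asb.
have [m0 n0] : 0 < m /\ 0 < n by rewrite !order_gt0.
have [a0 c0] := (dvdn_gt0 m0 am, dvdn_gt0 n0 cn).
have [/dvdnP[m' Dm] /dvdnP[n' Dn]] := (am, cn).
(* e j i is the sum of j times the generator (- s, c) and i times (a, 0); the
   exponent m.-1 * s stands for - s modulo m. *)
pose e j i := (g ^+ (m.-1 * s * j + a * i), h ^+ (c * j))%g.
pose l := [seq e j i | j <- iota 0 n', i <- iota 0 m'].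
have ul : uniq l.
  apply: allpairs_uniq; rewrite ?iota_uniq // => -[j i] [j' i'].
  rewrite !mem_pairs !mem_iota /= !add0n.
  move=> /andP[jn im] /andP[jn' im'] [/eqP E1 /eqP].
  rewrite eq_expg_mod_order -/n Dn (mulnC n') -!muln_modr !modn_small //.
  rewrite eqn_pmul2l // => /eqP Dj; subst j'; move: E1.
  rewrite eq_expg_mod_order -/m eqn_modDl Dm (mulnC m') -!muln_modr !modn_small //.
  by rewrite eqn_pmul2l // => /eqP ->.
have lP : l =i sublattice_group g h a c s.
  move=> p; apply/allpairsPdep/idP => [[j [i [_ _ ->]]]|pF].
    rewrite mem_sublattice_group // /sublattice dvdn_mulr // mulKn //=.
    have -> : m.-1 * s * j + a * i + s * j = m * (s * j) + a * i by nia.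
    by rewrite dvdn_add ?dvdn_mulr.
  have /setX_cycleP[u [v Dp]] := subsetP (sublattice_group_subX g h a c s) p pF.
  move: pF; rewrite Dp -(expg_mod_order h) mem_sublattice_group // -/n.
  have := ltn_pmod v n0; move: (v %% n) => {Dp}v vn /andP[/dvdnP[j Dv]].
  rewrite Dv mulnK // => /dvdnP[w Dw].
  exists j, (w %% m'); rewrite !mem_iota !add0n /= ltn_pmod; last by nia.
  have -> : j < n' by nia.
  split=> //; rewrite /e (mulnC c); congr (_, _); apply/eqP.
  rewrite eq_expg_mod_order -/m -(eqn_modDr (s * j)) Dw addnAC.
  have -> : m.-1 * s * j + s * j = m * (s * j) by nia.
  rewrite (mulnC m) modnMDl Dm (mulnC w) (mulnC m').
  by rewrite -!muln_modr modn_mod.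
rewrite -(eq_card lP) (card_uniqP ul) size_allpairs !size_iota.
by rewrite Dm Dn !mulnK // mulnC.
Qed.

(** Every subgroup comes from a lattice in normal form: the existence part of
    the Hermite normal form. *)
Lemma subgroup_of_setX_cycle {gT1 gT2 : finGroupType} (g : gT1) (h : gT2)
    (H : {group (gT1 * gT2)%type}) :
    H \subset setX <[g]>%g <[h]>%g ->
  exists a c s, [/\ a %| #[g]%g, c %| #[h]%g, s < a, a %| s * (#[h]%g %/ c)
    & H = sublattice_group g h a c s].
Proof.
set m := #[g]%g; set n := #[h]%g => sHX.
have [m0 n0] : 0 < m /\ 0 < n by rewrite !order_gt0.
pose P u v := (g ^+ u, h ^+ v)%g \in H.
have PD u v u' v' : P u v -> P (u + u') (v + v') = P u' v'.
  by move=> Puv; rewrite /P !expgD -mulg_pair groupMl.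
have PM u v i : P u v -> P (u * i) (v * i).
  by move=> Puv; rewrite /P !expgM -expg_pair groupX.
have Pm i : P (m * i) 0 by rewrite /P expgM expg_order expg1n group1.
have Pn : P 0 n by rewrite /P expg_order group1.
have PmD u v i : P (m * i + u) v = P u v by rewrite -(PD (m * i) 0 u v).
have predmD w u : w + (u + m.-1 * w) = m * w + u.
  by rewrite -[in RHS](prednK m0) mulSn addnA addnAC.
(* a is the least positive exponent of H on the first axis. *)
have exa : exists a, (0 < a) && P a 0 by exists m; rewrite m0 -(muln1 m) Pm.
have [a /andP[a0 Pa] min_a] := ex_minnP exa.
have PaE u : P u 0 = (a %| u).
  apply/idP/dvdnP => [|[i ->]]; last by rewrite mulnC -[0](mul0n i) PM.
  rewrite {1}(divn_eq u a) mulnC -(addn0 0) PD; last by rewrite -[0](mul0n (u %/ a)) PM.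
  move=> Pr; exists (u %/ a); rewrite {1}(divn_eq u a).
  have [->|r0] := posnP (u %% a); first by rewrite addn0.
  by have := min_a (u %% a); rewrite r0 Pr leqNgt ltn_pmod // => /(_ isT).
have am : a %| m by rewrite -PaE -(muln1 m) Pm.
(* c is the least positive second exponent occurring in H, in the pair
   (u0, c). *)
have exc : exists c, (0 < c) && [exists u : 'I_m, P u c].
  by exists n; rewrite n0; apply/existsP; exists (Ordinal m0).
have [c /andP[c0 /existsP[u0 Pc]] min_c] := ex_minnP exc.
have colP u v : P u v -> c %| v.
  move=> Puv; have [v0|r0] := posnP (v %% c); first exact/eqP.
  (* Subtracting v %/ c times (u0, c) from (u, v), with m.-1 for - 1. *)
  have Pr : P (u + m.-1 * (u0 * (v %/ c))) (v %% c).
    rewrite -(PD _ _ _ _ (PM _ _ (v %/ c) Pc)) [c * _]mulnC -divn_eq.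
    by rewrite predmD PmD.
  have := min_c (v %% c); rewrite r0 leqNgt ltn_pmod //=.
  move=> /(_ _)/negP[]//; apply/existsP.
  exists (Ordinal (ltn_pmod (u + m.-1 * (u0 * (v %/ c))) m0)).
  by rewrite /P /= expg_mod_order.
have cn : c %| n := colP _ _ Pn.
(* Since (u0, c) plays the role of (- s, c), s represents - u0 modulo a. *)
pose s := (m.-1 * u0) %% a.
have sa : s < a by rewrite ltn_pmod.
(* With v = j * c, subtracting j times (u0, c) moves (u, v) to the first axis,
   where PaE applies. *)
have PE u v : P u v = sublattice a c s u v.
  rewrite /sublattice; case: (boolP (c %| v)) => [/dvdnP[j ->]|]; last first.
    by apply: contraNF => /colP.
  rewrite mulnK // -(PmD u _ (u0 * j)).
  rewrite -predmD -(addn0 (j * c)) (mulnC j) PD ?PM // PaE /=.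
  by rewrite /dvdn mulnA -modnDmr -modnMml modnDmr.
have asb : a %| s * (n %/ c).
  by move: Pn; rewrite PE /sublattice add0n => /andP[].
exists a, c, s; split=> //; apply/val_inj/setP => p /=.
apply/idP/idP => pH.
  have /setX_cycleP[u [v Dp]] := subsetP sHX p pH.
  by rewrite Dp mem_sublattice_group // -PE /P -Dp.
have /setX_cycleP[u [v Dp]] := subsetP (sublattice_group_subX g h a c s) p pH.
by move: pH; rewrite Dp mem_sublattice_group // -PE.
Qed.

Lemma divn_dvd_gt0 d n : 0 < n -> d %| n -> 0 < n %/ d.
Proof. by move=> n0 dn; rewrite divn_gt0 ?(dvdn_gt0 n0 dn) // dvdn_leq. Qed.

Lemma dvdn_divnK d n : 0 < n -> d %| n -> n %/ (n %/ d) = d.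
Proof. by move=> n0 dn; rewrite -{1}(divnK dn) mulKn // divn_dvd_gt0. Qed.

(** The first formula, for any two cyclic groups. *)
Lemma num_subgroups_setX_cycle {gT1 gT2 : finGroupType} (g : gT1) (h : gT2) k :
  num_subgroups (setX_group <[g]> <[h]>) k =
  \sum_(p <- divisor_pairs k #[g]%g #[h]%g) gcdn p.1 p.2.
Proof.
set m := #[g]%g; set n := #[h]%g.
have [m0 n0] : 0 < m /\ 0 < n by rewrite !order_gt0.
(* T lists the parameters (a, b, s); F t has second lattice parameter n %/ b. *)
pose T := [seq (p, s) | p <- divisor_pairs k m n,
  s <- [seq s <- iota 0 p.1 | p.1 %| s * p.2]].
pose F (t : nat * nat * nat) := sublattice_group g h t.1.1 (n %/ t.1.2) t.2.
have TP a b s : ((a, b, s) \in T) =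
    [&& a %| m, b %| n, m * b == k * a, s < a & a %| s * b].
  apply/allpairsPdep/and5P => [[[a' b'] [s' []]]|[am bn E sa asb]].
    rewrite mem_divisor_pairs // mem_filter mem_iota add0n /=.
    by move=> /and3P[am bn E] /andP[asb sa] [-> -> ->].
  exists (a, b), s; rewrite mem_divisor_pairs // mem_filter mem_iota /=.
  by rewrite am bn E asb.
have uT : uniq T.
  apply: allpairs_uniq_dep => [|p _|]; rewrite ?divisor_pairs_uniq //.
    by rewrite filter_uniq ?iota_uniq.
  by move=> [? ?] [? ?] _ _ /= [-> ->].
have F_inj : {in T &, injective F}.
  move=> [[a b] s] [[a' b'] s']; rewrite !TP.
  move=> /and5P[am bn _ sa asb] /and5P[am' bn' _ sa' asb'] E.
  have [] := @sublattice_inj a (n %/ b) s a' (n %/ b') s' => //.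
  - exact: dvdn_gt0 am.
  - exact: dvdn_gt0 am'.
  - exact: divn_dvd_gt0.
  - exact: divn_dvd_gt0.
  - move=> u v; have := congr1 (fun H : {group _} => (g ^+ u, h ^+ v)%g \in H) E.
    by rewrite !mem_sublattice_group ?dvdn_divnK ?dvdn_div.
  move=> -> E2 ->; congr (_, _, _).
  by rewrite -(dvdn_divnK b n) // E2 dvdn_divnK.
transitivity (size (map F T)).
  rewrite /num_subgroups -(card_uniqP _); last by rewrite map_inj_in_uniq.
  apply: eq_card => H; rewrite inE /=; apply/andP/mapP.
    case=> /[!inE] sHX /eqP cardH.
    have [a [c [s [am cn sa asc DH]]]] := subgroup_of_setX_cycle _ _ _ sHX.
    have c0 := dvdn_gt0 n0 cn.
    exists (a, n %/ c, s); last by rewrite /F /= dvdn_divnK.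
    rewrite TP am dvdn_div // sa asc /= andbT -cardH DH.
    by rewrite card_sublattice_group // -/m -/n mulnAC divnK.
  case=> -[[a b] s]; rewrite TP => /and5P[am bn /eqP E sa asb ->].
  rewrite inE sublattice_group_subX; split=> //.
  rewrite card_sublattice_group ?dvdn_divnK ?dvdn_div //.
  by rewrite -(eqn_pmul2r (dvdn_gt0 m0 am)) -E -/m mulnAC divnK.
rewrite size_map -sum1_size big_allpairs_dep; apply: eq_big_seq => -[a b].
rewrite mem_divisor_pairs // => /and3P[am _ _].
by rewrite sum1_size size_annihilators // (dvdn_gt0 m0 am).
Qed.

(** This includes n = 1, where ['Z_1] has two elements but [Zp 1] is trivial. *)
Lemma Zp_cyclic n : 0 < n -> exists2 g : 'Z_n, Zp n = <[g]>%g & #[g]%g = n.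
Proof.
move=> n0; have [g Dg] : exists g : 'Z_n, Zp n = <[g]>%g.
  rewrite /Zp; case: ifP => _; last by exists 1%g; rewrite cycle1.
  by exists Zp1; rewrite Zp_cycle.
by exists g => //; rewrite orderE -Dg card_Zp.
Qed.

Lemma num_subgroups_ZxZ k m n : 0 < m -> 0 < n ->
  num_subgroups (ZxZ m n) k = \sum_(p <- divisor_pairs k m n) gcdn p.1 p.2.
Proof.
move=> m0 n0; have [g Dg og] := Zp_cyclic m m0; have [h Dh oh] := Zp_cyclic n n0.
rewrite -[in RHS]og -[in RHS]oh -num_subgroups_setX_cycle; congr num_subgroups.
by apply/val_inj; rewrite /= Dg Dh.
Qed.

Theorem theorem4 (k m n : nat) (k_gt0 : 0 < k) (m_gt0 : 0 < m) (n_gt0 : 0 < n)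
    (k_dvd_mn : k %| m * n) :
  [/\ num_subgroups (ZxZ m n) k =
        \sum_(a <- divisors m)
          \sum_(b <- divisors n | m * b %/ a == k) gcdn a b,
      num_subgroups (ZxZ m n) k =
        \sum_(d <- divisors (gcdn k m))
          \sum_(e <- divisors (gcdn k n) | k %| d * e) totient (d * e %/ k)
    & num_subgroups (ZxZ m n) k =
        \sum_(d <- divisors (gcdn (gcdn m n) k))
          totient d * num_solutions (m %/ d) (n %/ d) (k %/ d)].
Proof.
rewrite num_subgroups_ZxZ // big_divisor_pairs; split=> //.
  exact: sum_gcdn_totient_mul.
exact: sum_gcdn_num_solutions.
Qed.
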